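(* Let $X$ be a Hausdorff topological space with a countable $k$-network (for example, an $\aleph_0$-space) and let $\mathcal I$ be a discretely-complete ideal of compact subsets of $X$. If a topological space $Y$ has the strong Pytkeev property at a point $y_0\in Y$, then the function space $C_{\mathcal I}(X,Y)$ has the strong Pytkeev property at the constant function $f:X\to\{y_0\}\subset Y$.
   Context: A subset $A$ of a topological space $X$ accumulates at a point $x\in X$ if each neighborhood of $x$ contains infinitely many points of $A$. A topological space $X$ has the strong Pytkeev property at a point $x\in X$ if there is a countable family $\mathcal N$ of subsets of $X$ such that for every neighborhood $O_x\subset X$ of $x$ and every subset $A\subset X$ accumulating at $x$ there is a set $N\in\mathcal N$ such that $N\subset O_x$ and $N\cap A$ is infinite. A family $\mathcal N$ of subsets of a topological space $X$ is a $k$-network in $X$ if for any open set $U\subset X$ and compact subset $K\subset U$ there is a finite subfamily $\mathcal F\subset\mathcal N$ such that $K\subset\bigcup\mathcal F\subset U$. An $\aleph_0$-space is a regular (in particular Hausdorff) topological space with a countable $k$-network. A family $\mathcal I$ of compact subsets of a topological space $X$ is an ideal of compact subsets if $\bigcup\mathcal I=X$ and for any $A,B\in\mathcal I$ and any compact subset $K\subset X$ we have $A\cup B\in\mathcal I$ and $A\cap K\in\mathcal I$. The ideal $\mathcal I$ is discretely-complete if for any compact subsets $A,B\subset X$ such that $A\setminus B$ is a countable discrete subspace of $X$, the inclusion $B\in\mathcal I$ implies $A\in\mathcal I$. $C_{\mathcal I}(X,Y)$ denotes the set of all continuous functions from $X$ to $Y$ with the topology generated by the subbase consisting of the sets $[K;U]=\{f: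 f(K)\subset U\}$, where $K\in\mathcal I$ and $U\subset Y$ is open. *)

(* Defs.v *)
From HB Require Import structures.
From mathcomp Require Import all_boot all_order all_algebra.
From mathcomp Require Import all_classical.
From mathcomp Require Import topology.

Set Implicit Arguments.
Unset Strict Implicit.
Unset Printing Implicit Defensive.

Local Open Scope classical_set_scope.

Definition accum_at (X : topologicalType) (A : set X) (x : X) : Prop :=
  forall U : set X, nbhs x U -> infinite_set (U `&` A).

Definition strong_pytkeev_at (X : topologicalType) (x : X) : Prop :=
  exists N : set (set X), countable N /\
    forall (O : set X) (A : set X), nbhs x O -> accum_at A x ->
      exists M : set X, [/\ N M, M `<=` O & infinite_set (M `&` A)].

Definition k_network (X : topologicalType) (N : set (set X)) : Prop :=
  forall U K : set X, open U -> compact K -> K `<=` U ->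
    exists F : set (set X), [/\ F `<=` N, finite_set F,
      K `<=` \bigcup_(M in F) M & \bigcup_(M in F) M `<=` U].

Definition compact_ideal (X : topologicalType) (I : set (set X)) : Prop :=
  [/\ I `<=` compact,
      \bigcup_(K in I) K = [set: X],
      forall A B : set X, I A -> I B -> I (A `|` B)
    & forall A K : set X, I A -> compact K -> I (A `&` K)].

(* The coercion of [S] to the type of its elements carries the subspace
   topology, so the condition says that all subsets of this space are open. *)
Definition discrete_subspace (X : topologicalType) (S : set X) : Prop :=
  forall B : set S, open B.

Definition discretely_complete (X : topologicalType) (I : set (set X)) : Prop :=
  forall A B : set X, compact A -> compact B ->
    countable (A `\` B) -> discrete_subspace (A `\` B) -> I B -> I A.

(* The family [I] occurs only as a parameter selecting the topology. *)
Definition CI (X : topologicalType) (I : set (set X)) (Y : topologicalType)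
  : Type := continuousType X Y.

HB.instance Definition _ (X : topologicalType) (I : set (set X))
  (Y : topologicalType) := Choice.on (CI I Y).

HB.instance Definition _ (X : topologicalType) (I : set (set X))
    (Y : topologicalType) :=
  @isSubBaseTopological.Build (CI I Y) (set X * set Y)%type
    [set KU | I KU.1 /\ open KU.2]
    (fun KU => [set f : continuousType X Y | f @` KU.1 `<=` KU.2]).

Definition CI_cst (X : topologicalType) (I : set (set X)) (Y : topologicalType)
  (y : Y) : CI I Y := (cst y : continuousType X Y).

(* Main.v *)
Require Import Defs.
From mathcomp Require Import all_boot finmap all_classical topology.

Set Implicit Arguments.
Unset Strict Implicit.
Unset Printing Implicit Defensive.

Local Open Scope classical_set_scope.

(** The countable family that works at the constant function consists of the
    sets [M; P] of all functions mapping M into P, where M is a finite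
    intersection of finite unions of members of the k-network of X, and P is a
    finite union of members of the family given at y0, enlarged by the
    intersection Z of all neighbourhoods of y0.  Given a basic neighbourhood
    [K; U], the k-network provides a decreasing sequence M_n of such sets
    shrinking to K, and the family at y0 an increasing sequence P_n of such
    sets inside U with the following property: a set that misses P_0 and meets
    every P_n in a finite set misses a neighbourhood of y0
    ([pytkeev_inner_sequence]).  It remains to see that a set A of functions
    clustering at the constant function meets some [M_n; P_n] in an infinite
    set.  Suppose that it does not.

    First, some neighbourhood V of y0 is such that each f in [K; V] lies in
    some [M_n; P_n] ([eventually_into_inner]).  A function f outside all of
    them has points x_(f,n) in M_n with f(x_(f,n)) outside P_n, and these
    cluster at a point c_f of K.  If V did not exist, the closure of the set of
    values f(c_f) would contain y0, and by countable tightness of Y at y0 so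
    would the closure of countably many of them, f_k(c_(f_k)).  The value of
    f_k at x_(f_k,m) lies outside P_m, so only finitely many of these values
    with k <= m lie in a given P_n: together they miss an open neighbourhood W
    of y0.  For one k the point f_k(c_(f_k)) lies in W, and continuity brings
    some f_k(x_(f_k,m)) with m >= k into W, a contradiction.

    Consequently the functions of A in [K; V] form a countable set, finitely
    many lying in each [M_n; P_n] ([infinite_into_inner]).  For such an f
    outside [M_0; P_0], let n be the last level before f enters the sequence,
    and choose x_f in M_n with f(x_f) outside P_n.  All but finitely many x_f
    lie in any given M_n, so K together with all x_f is compact and differs
    from K by a countable discrete set; hence it belongs to the ideal.  The
    values f(x_f) meet each P_n in a finite set, so they miss a neighbourhood W
    of y0.  But then the neighbourhood of the constant function given by this
    larger compact set and by the intersection of V and W contains only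
    functions of A from [M_0; P_0], which are finitely many, a
    contradiction. *)

(** * Countable families and filters *)

Definition finite_unions (T : Type) (S : set (set T)) : set (set T) :=
  [set \bigcup_(A in F) A | F in [set F | F `<=` S /\ finite_set F]].

Definition finite_intersections (T : Type) (S : set (set T)) : set (set T) :=
  [set \bigcap_(A in F) A | F in [set F | F `<=` S /\ finite_set F]].

Lemma countable_image (T U : Type) (f : T -> U) (A : set T) :
  countable A -> countable (f @` A).
Proof. by apply: sub_countable; exact: card_image_le. Qed.

Lemma countable_finite_unions (T : Type) (S : set (set T)) :
  countable S -> countable (finite_unions S).
Proof. by move=> cS; apply/countable_image/countable_finite_subset. Qed.

Lemma countable_finite_intersections (T : Type) (S : set (set T)) :
  countable S -> countable (finite_intersections S).
Proof. by move=> cS; apply/countable_image/countable_finite_subset. Qed.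

(** Every countable set is an increasing union of finite subsets; used to turn
    countable families into monotone sequences of finite unions or
    intersections. *)
Lemma countable_exhaustion (T : Type) (S : set T) : countable S ->
  exists F : nat -> set T,
    [/\ forall n, F n `<=` S, forall n, finite_set (F n),
        forall m n, m <= n -> F m `<=` F n
      & forall x, S x -> exists n, F n x].
Proof.
move=> /pfcard_geP[->|[d]].
  by exists (fun=> set0); split=> // [n|m n _] x.
exists (fun n => d @` `I_n.+1); split.
- by move=> n _ [k _ <-]; exact/funS.
- by move=> n; exact: finite_image.
- by move=> m n mn _ [k /= km <-]; exists k => //=; exact: leq_trans mn.
- by move=> x /(@surj _ _ _ _ d)[n _ <-]; exists n, n => /=.
Qed.

Lemma filter_setC_finite (T : Type) (G : set_system T) (F : set T) :
  Filter G -> finite_set F -> (forall y, F y -> G (~` [set y])) -> G (~` F).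
Proof.
move=> FG; elim/Pchoice: T => T in G F FG *.
move=> /finite_fsetP[X ->] GF.
apply: filterS (filter_bigI (f := fun y => ~` [set y]) FG GF).
by move=> z Xz zX; exact: (Xz z zX).
Qed.

(** * The strong Pytkeev property at a point of Y *)

(** The condition on [P 0] is there because a point common to all
    neighbourhoods of [y0] cannot be avoided; when [P 0] contains all such
    points, a set disjoint from it has none. *)
Definition inner_sequence (Y : topologicalType) (y0 : Y)
    (P : nat -> set Y) : Prop :=
  (forall m n, m <= n -> P m `<=` P n) /\
  forall E, E `&` P 0 = set0 -> (forall n, finite_set (E `&` P n)) ->
    nbhs y0 (~` E).

(** If a set missing [P 0] has finite trace on each [P n], it cannot cluster at
    [y0], since otherwise the Pytkeev property would find a member of the family
    inside [U], hence inside some [P n], with infinite trace.  So it has finite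
    trace on a neighbourhood of [y0], and these finitely many points can be
    removed. *)
Lemma pytkeev_inner_sequence (Y : topologicalType) (y0 : Y) :
  strong_pytkeev_at y0 ->
  exists PP : set (set Y), countable PP /\ forall U, nbhs y0 U ->
  exists P : nat -> set Y,
    [/\ forall n, PP (P n), forall n, P n `<=` U & inner_sequence y0 P].
Proof.
move=> [N [cN HN]].
(* Adding [Z] to the sets [P n] ensures that every point outside [P 0] is
   avoided by some neighbourhood of [y0], although [Y] need not be T1. *)
pose Z := [set z | forall U, nbhs y0 U -> U z].
exists [set Z `|` A | A in finite_unions N]; split.
  exact/countable_image/countable_finite_unions.
move=> U yU.
have cNU : countable (N `&` [set M | M `<=` U]).
  by apply: sub_countable cN; apply: subset_card_le => M [].
have [F [FS Ffin Fmono Fex]] := countable_exhaustion cNU.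
exists (fun n => Z `|` \bigcup_(A in F n) A); split.
- move=> n; exists (\bigcup_(A in F n) A) => //; exists (F n) => //.
  by split=> // A /FS[].
- by move=> n z [/(_ _ yU)//|[A /FS[_]]]; exact.
split.
  move=> m n mn z [Zz|[A FA Az]]; first by left.
  by right; exists A => //; exact: Fmono FA.
move=> E E0 Efin.
have nE z : E z -> nbhs y0 (~` [set z]).
  move=> Ez; have : ~ Z z.
    move=> Zz; have : (E `&` (Z `|` \bigcup_(A in F 0) A)) z.
      by split=> //; left.
    by rewrite E0.
  apply: contra_notP => nz V yV; apply: contra_notP nz => nVz.
  by apply: filterS yV => w Vw /= wz; apply: nVz; rewrite -wz.
have [acc|] := pselect (accum_at E y0).
  have [M [NM MU []]] := HN _ _ yU acc.
  have [n FnM] := Fex M (conj NM MU).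
  apply: sub_finite_set (Efin n) => z [Mz Ez]; split => //.
  by right; exists M.
move=> /existsNP[V /not_implyP[yV /contrapT Vfin]].
have : nbhs y0 (~` (V `&` E)).
  by apply: filter_setC_finite => // z [_ /nE].
by move=> /(filterI yV); apply: filterS => z [Vz nVE] Ez; apply: nVE.
Qed.

(** Choosing a point of [G] in each member of the family that meets [G] gives a
    countable subset of [G] with [y0] in its closure. *)
Lemma pytkeev_countable_tightness (Y : topologicalType) (y0 : Y) (G : set Y) :
  strong_pytkeev_at y0 ->
  (forall W, nbhs y0 W -> W `&` G !=set0) ->
  exists d : nat -> Y, (forall n, G (d n)) /\
    forall W, nbhs y0 W -> exists n, W (d n).
Proof.
move=> [N [cN HN]] Gcl.
suff [D [cD DG DW]] : exists D, [/\ countable D, D `<=` G &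
    forall W, nbhs y0 W -> W `&` D !=set0].
  have /pfcard_geP[D0|[d]] := cD.
    by have [z] := DW _ filterT; rewrite D0 => -[].
  exists d; split=> [n|W /DW[z [Wz Dz]]]; first by apply/DG/funS.
  by have [n _ dn] := @surj _ _ _ _ d z Dz; exists n; rewrite dn.
have [acc|] := pselect (accum_at G y0).
  have [z0 [_ Gz0]] := Gcl _ filterT.
  have /choice[p Hp] : forall M : set Y, exists z,
      M `&` G !=set0 -> (M `&` G) z.
    move=> M; have [[z Mz]|nM] := pselect (M `&` G !=set0); first by exists z.
    by exists z0.
  exists [set p M | M in N `&` [set M | M `&` G !=set0]]; split.
  - apply: countable_image; apply: sub_countable cN.
    by apply: subset_card_le => M [].
  - by move=> _ [M [_ /= /Hp[_ ?]] <-].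
  - move=> W yW; have [M [NM MW /infinite_setN0 M0]] := HN _ _ yW acc.
    by exists (p M); split; [apply: MW; have [] := Hp _ M0|exists M].
move=> /existsNP[V /not_implyP[yV /contrapT Vfin]].
exists (V `&` G); split=> //; first exact: finite_set_countable.
by move=> W yW; rewrite setIA; apply/Gcl/filterI.
Qed.

(** * Sequences shrinking to a compact subset of X *)

Definition outer_sequence (X : topologicalType) (K : set X)
    (M : nat -> set X) : Prop :=
  [/\ forall n, K `<=` M n, forall m n, m <= n -> M n `<=` M m
    & forall O, open O -> K `<=` O -> exists n, M n `<=` O].

Lemma countable_k_network_outer (X : topologicalType) (N : set (set X)) :
  countable N -> k_network N ->
  exists MM : set (set X), countable MM /\ forall K, compact K ->
  exists M, (forall n, MM (M n)) /\ outer_sequence K M.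
Proof.
move=> cN kN.
exists (finite_intersections (finite_unions N)); split.
  exact/countable_finite_intersections/countable_finite_unions.
move=> K cK.
have cNK : countable (finite_unions N `&` [set M | K `<=` M]).
  apply: sub_countable (countable_finite_unions cN).
  by apply: subset_card_le => M [].
have [F [FS Ffin Fmono Fex]] := countable_exhaustion cNK.
exists (fun n => \bigcap_(A in F n) A); split; last split.
- by move=> n; exists (F n) => //; split=> // A /FS[].
- by move=> n x Kx A /FS[_]; exact.
- by move=> m n mn x Fx A /(Fmono _ _ mn); exact: Fx.
- move=> O oO KO; have [F' [F'N F'fin KF' F'O]] := kN _ _ oO cK KO.
  have [|n Fn] := Fex (\bigcup_(M in F') M); first by split=> //; exists F'.
  by exists n => x /(_ _ Fn) /F'O.
Qed.

(** The sets [K `&` closure B], for [B] in [F], are nonempty: otherwise the open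
    set [~` closure B] would contain [K], hence some [M n], which [B] meets.
    By compactness the filter that they generate clusters in [K]. *)
Lemma outer_sequence_cluster (X : topologicalType) (K : set X) M
    (F : set_system X) :
  compact K -> outer_sequence K M -> ProperFilter F ->
  (forall B n, F B -> B `&` M n !=set0) -> K `&` cluster F !=set0.
Proof.
move=> cK [_ _ MO] FF FM.
pose G := filter_from F (fun B => K `&` closure B).
have GF : ProperFilter G.
  apply: filter_from_proper.
    apply: filter_from_filter; first by exists setT; exact: filterT.
    move=> A B FA FB; exists (A `&` B); first exact: filterI.
    by move=> x [Kx cx]; split; split=> //; apply: closure_subset cx => ? [].
  move=> B FB; apply: contrapT => KB.
  have [||n Mn] := MO (~` closure B).
  - exact/closed_openC/closed_closure.
  - by move=> x Kx cx; apply: KB; exists x.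
  - by have [x [Bx /Mn]] := FM _ n FB; apply; exact: subset_closure.
have [|p [Kp pG]] := cK G GF.
  by exists setT; [exact: filterT|move=> x []].
exists p; split=> // B U FB pU.
have [|q [[_ cq] Uq]] := pG (K `&` closure B) U° _ (nbhs_interior pU).
  by exists B.
have [z [Bz Uz]] := cq _ (open_nbhs_nbhs (conj (open_interior U) Uq)).
by exists z; split=> //; exact: interior_subset.
Qed.

(** A filter on [K `|` Q] either meets every [M n], and then clusters in [K], or
    contains a finite set [Q `\` M n], and then clusters in it. *)
Lemma compact_setU_outer (X : topologicalType) (K Q : set X) M :
  compact K -> outer_sequence K M ->
  (forall n, finite_set (Q `\` M n)) -> compact (K `|` Q).
Proof.
move=> cK KM Qfin F FF FKQ.
have [FM|] := pselect (forall B n, F B -> B `&` M n !=set0).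
  have [x [Kx Fx]] := outer_sequence_cluster cK KM FF FM.
  by exists x; split=> //; left.
move=> /existsNP[B /existsNP[n /not_implyP[FB /set0P/negP/negPn/eqP BM]]].
have [|x [[Qx _] Fx]] := finite_compact (Qfin n) FF.
  apply: filterS (filterI FB FKQ) => x [Bx KQx].
  have nMx : ~ M n x by move=> Mx; have : (B `&` M n) x by []; rewrite BM.
  by split=> //; case: KQx => // Kx; case: nMx; case: KM => /(_ n x Kx).
by exists x; split=> //; right.
Qed.

(** A point [x] outside [K] has a neighbourhood missing some [M n], because in a
    Hausdorff space the neighbourhood filter of [x] clusters only at [x].  This
    neighbourhood contains finitely many points of [Q]. *)
Lemma discrete_setU_outer (X : topologicalType) (K Q : set X) M :
  hausdorff_space X -> compact K -> outer_sequence K M ->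
  (forall n, finite_set (Q `\` M n)) ->
  discrete_subspace ((K `|` Q) `\` K).
Proof.
move=> hX cK KM Qfin B.
have nb x : ~ K x -> nbhs x (~` (Q `\ x)).
  move=> nKx.
  have [FM|] := pselect (forall C n, nbhs x C -> C `&` M n !=set0).
    have [z [Kz xz]] := outer_sequence_cluster cK KM (nbhs_pfilter x) FM.
    by case: nKx; rewrite (hX _ _ xz).
  move=> /existsNP[C /existsNP[n /not_implyP[xC /set0P/negP/negPn/eqP CM]]].
  have : nbhs x (~` ((Q `\` M n) `\ x)).
    apply: filter_setC_finite => [|y [_ yx]].
      by apply: sub_finite_set (Qfin n) => ? [].
    have /closed_openC oy : closed [set y].
      exact/accessible_closed_set1/hausdorff_accessible.
    apply: open_nbhs_nbhs; split=> // xy.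
    by apply: yx; rewrite -xy.
  apply: filterS2 xC => z Cz nQz [Qz zx]; apply: nQz; split=> //; split=> // Mz.
  by have : (C `&` M n) z by []; rewrite CM.
exists (\bigcup_(s in B) (~` (Q `\ set_val s))°).
  by apply: bigcup_open => s _; exact: open_interior.
apply/seteqP; split=> s.
  move=> [t Bt /interior_subset /= nst].
  suff -> : s = t by [].
  apply: val_inj; apply: contrapT => st; apply: nst; split => //.
  by have /set_mem[[]] := valP s.
move=> Bs; exists s => //.
by apply/nb; have /set_mem[] := valP s.
Qed.

(** * Sets of functions avoiding all the sets [M n; P n] *)

Definition maps_into (X Y : topologicalType) (M : set X) (P : set Y) :
  set (continuousType X Y) := [set f | f @` M `<=` P].

Lemma maps_intoP (X Y : topologicalType) (M : set X) (P : set Y)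
  (f : continuousType X Y) : ~ maps_into M P f -> exists2 x, M x & ~ P (f x).
Proof.
move=> nf; apply: contrapT => H; apply: nf => _ [x Mx <-].
by apply: contrapT => nP; apply: H; exists x.
Qed.

Lemma maps_intoS (X Y : topologicalType) (M M' : set X) (P P' : set Y) :
  M' `<=` M -> P `<=` P' -> @maps_into X Y M P `<=` maps_into M' P'.
Proof. by move=> MM PP f fMP _ [x /MM Mx <-]; apply/PP/fMP; exists x. Qed.

(** A function that never enters [M n; P n] has witnesses of this failure
    clustering at a point of [K]. *)
Lemma never_into_cluster (X Y : topologicalType) (K : set X) M
    (P : nat -> set Y) (f : continuousType X Y) :
  compact K -> outer_sequence K M -> (forall n, ~ maps_into (M n) (P n) f) ->
  exists xc : (nat -> X) * X,
    [/\ forall n, ~ P n (f (xc.1 n)), K xc.2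
      & forall U n, nbhs xc.2 U -> exists2 m, n <= m & U (xc.1 m)].
Proof.
move=> cK KM nf; have [_ MM _] := KM.
have /choice[x Hx] : forall n, exists x, M n x /\ ~ P n (f x).
  by move=> n; have [x] := maps_intoP (nf n); exists x.
have [|c [Kc xc]] := outer_sequence_cluster cK KM (F := x @ \oo).
  move=> B n [m _ mB]; exists (x (maxn m n)); split.
    by apply: mB => /=; exact: leq_maxl.
  by apply: (MM n); [exact: leq_maxr|have [] := Hx (maxn m n)].
exists (x, c); split=> //= [n|U n cU]; first by have [] := Hx n.
have [|z [[m /= nm <-] Uz]] := xc (x @` [set m | n <= m]) U _ cU.
  by exists n => // m nm; exists m.
by exists m.
Qed.

(** The sets [P n] cover a neighbourhood of [y0], but a compact subset of this
    neighbourhood need not lie in one of them, so a single function may escape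
    all [M n; P n].  At the cluster points of their witnesses, however, such
    functions take values away from [y0]: otherwise countably many of these
    values would approach [y0], while a diagonal set of witnesses would have
    values missing a neighbourhood of [y0], against continuity. *)
Lemma eventually_into_inner (X Y : topologicalType) (x0 : X) (y0 : Y)
    (K : set X) M P :
  strong_pytkeev_at y0 -> compact K -> outer_sequence K M ->
  inner_sequence y0 P ->
  exists V, nbhs y0 V /\ forall f : continuousType X Y, maps_into K V f ->
    exists n, maps_into (M n) (P n) f.
Proof.
move=> hY cK KM [PP yE].
pose Bad := [set f : continuousType X Y | forall n, ~ maps_into (M n) (P n) f].
have /choice[xc Hxc] : forall f, exists xc : (nat -> X) * X, Bad f ->
    [/\ forall n, ~ P n (f (xc.1 n)), K xc.2
      & forall U n, nbhs xc.2 U -> exists2 m, n <= m & U (xc.1 m)].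
  move=> f; have [Bf|nBf] := pselect (Bad f); last by exists (fun=> x0, x0).
  by have [xc Hxc] := never_into_cluster cK KM Bf; exists xc.
pose G := [set f ((xc f).2) | f in Bad].
have [Gcl|] := pselect (forall W, nbhs y0 W -> W `&` G !=set0); last first.
  move=> /existsNP[V /not_implyP[yV VG]]; exists V; split=> // f fKV.
  apply: contrapT => nf; apply: VG.
  have Bf : Bad f by move=> n fn; apply: nf; exists n.
  exists (f (xc f).2); split; last by exists f.
  by apply: fKV; exists (xc f).2 => //; have [] := Hxc f Bf.
have [d [dG dW]] := pytkeev_countable_tightness hY Gcl.
have /choice[f Hf] : forall k, exists f, Bad f /\ f (xc f).2 = d k.
  by move=> k; have [f] := dG k; exists f.
have nP k m : ~ P m (f k ((xc (f k)).1 m)).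
  by have [+ _ _] := Hxc _ (Hf k).1; exact.
(* The restriction k <= m leaves finitely many pairs below each level and
   still keeps a tail of the witnesses of every [f k]. *)
pose v (km : nat * nat) := f km.1 ((xc (f km.1)).1 km.2).
pose E := v @` [set km | km.1 <= km.2].
have nE : nbhs y0 (~` E).
  apply: yE => [|n].
    by rewrite -subset0 => _ [[[k m] _ <-]] /= /(PP _ m (leq0n m)) /nP.
  suff : finite_set (v @` (`I_n `*` `I_n)).
    apply: sub_finite_set => _ [[[k m] /= km <-] Pn].
    have mn : m < n.
      by rewrite ltnNge; apply/negP => /PP /(_ _ Pn) /nP.
    by exists (k, m) => //; split=> //=; exact: leq_ltn_trans mn.
  by apply/finite_image/finite_setX; exact: finite_II.
have [k] := dW _ (nbhs_interior nE).
have [Bk <-] := Hf k => ck.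
have [_ _ near_c] := Hxc _ Bk.
have cU : nbhs (xc (f k)).2 (f k @^-1` (~` E)).
  by apply: (@cts_fun _ _ (f k)); exact: ck.
have [m km /= nEm] := near_c _ k cU; case: nEm.
by exists (k, m).
Qed.

(** Discrete completeness enters here: were all the traces finite, the last
    witnesses of failure of the functions of [A], added to [K], would form a
    member of [I] on which almost no function of [A] is close to [y0]. *)
Lemma infinite_into_inner (X Y : topologicalType) (x0 : X) (y0 : Y)
    (K : set X) M P (I : set (set X)) (A : set (continuousType X Y)) :
  hausdorff_space X -> strong_pytkeev_at y0 -> compact K ->
  outer_sequence K M -> inner_sequence y0 P ->
  discretely_complete I -> I K ->
  (forall L V, I L -> nbhs y0 V -> infinite_set (A `&` maps_into L V)) ->
  exists n, infinite_set (A `&` maps_into (M n) (P n)).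
Proof.
move=> hX hY cK KM yP hI IK accA.
apply: contrapT => /forallNP nA.
have {}nA n : finite_set (A `&` maps_into (M n) (P n)).
  by apply: contrapT; exact: nA.
have [_ MM _] := KM; have [PP yE] := yP.
have [V [yV KV]] := eventually_into_inner x0 hY cK KM yP.
pose S := A `&` maps_into K V `&` [set f | ~ maps_into (M 0) (P 0) f].
(* [px f] is the last level before [f] enters, with a witness of failure. *)
have Hlast (f : continuousType X Y) : exists px : nat * X, S f ->
    [/\ maps_into (M px.1.+1) (P px.1.+1) f, M px.1 px.2 & ~ P px.1 (f px.2)].
  have [[[Af /KV[n fn]] /= nf0]|] := pselect (S f); last by exists (0, x0).
  elim: n fn => // n IHn fn.
  have [/IHn//|/maps_intoP[x Mx nPx]] := pselect (maps_into (M n) (P n) f).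
  by exists (n, x).
have {Hlast}/choice[px Hpx] := Hlast.
pose p f := (px f).1; pose x f := (px f).2.
have early n : S `&` [set f | p f < n] `<=` A `&` maps_into (M n) (P n).
  move=> f [Sf /= pn]; split; first by case: Sf => -[].
  have [fp _ _] := Hpx f Sf.
  by apply: maps_intoS fp; [exact: MM|exact: PP].
have Sout n f : S f -> ~ p f < n -> M n (x f) /\ ~ P n (f (x f)).
  move=> Sf /negP; rewrite -leqNgt => np; have [_ Mx nPx] := Hpx f Sf.
  by split; [exact: MM np _ Mx|move/(PP _ _ np)].
pose Q := x @` S.
have Qfin n : finite_set (Q `\` M n).
  apply: sub_finite_set (finite_image x (nA n)) => _ [[f Sf <-] nMx].
  exists f => //; apply: early; split=> //=; apply: contrapT => /(Sout n f Sf).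
  by case.
have cQ : countable Q.
  apply: countable_image.
  have -> : S = \bigcup_n (S `&` [set f | p f < n]).
    apply/seteqP; split=> [f Sf|f [n _ [Sf _]]//].
    by exists (p f).+1 => //; split=> //=; exact: ltnSn.
  apply: bigcup_countable => // n _; apply: finite_set_countable.
  exact: sub_finite_set (early n) (nA n).
have IKQ : I (K `|` Q).
  apply: hI (IK) => //.
  - exact: compact_setU_outer cK KM Qfin.
  - apply: sub_countable cQ; apply: subset_card_le.
    by move=> z [[]].
  - exact: discrete_setU_outer hX cK KM Qfin.
pose E := [set f (x f) | f in S].
have nE : nbhs y0 (~` E).
  apply: yE => [|n].
    rewrite -subset0 => _ [[f Sf <-]].
    by have [_] := Sout 0 f Sf (elimF idP (ltn0 _)).
  pose v (f : continuousType X Y) := f (x f).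
  apply: sub_finite_set (finite_image v (nA n)).
  move=> _ [[f Sf <-] Pfx]; exists f => //; apply: early; split=> //=.
  by apply: contrapT => /(Sout n f Sf)[].
apply: (accA _ _ IKQ (filterI yV nE)); apply: sub_finite_set (nA 0).
move=> f [Af fKQ]; split=> //; apply: contrapT => nf0.
have Sf : S f.
  by split=> //; split=> //; apply: maps_intoS fKQ => [z|z []//]; left.
have [|_] := fKQ (f (x f)); first by exists (x f) => //; right; exists f.
by apply; exists f.
Qed.

(** * Neighbourhoods of a constant function *)

Lemma nbhs_CI_cst_maps_into (X Y : topologicalType) (I : set (set X)) (y0 : Y)
    K V :
  I K -> nbhs y0 V -> nbhs (CI_cst I y0) (maps_into K V : set (CI I Y)).
Proof.
move=> IK yV.
apply: (filterS (P := maps_into K V°)).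
  by apply: maps_intoS => //; exact: interior_subset.
apply: open_nbhs_nbhs; split; last first.
  by move=> _ [x _ <-].
have oV : open V° by exact: open_interior.
pose B : set (CI I Y) := maps_into K V°.
exists [set B]; last by rewrite bigcup_set1.
move=> _ ->.
exact: (@finI_from1 _ _ [set KU | I KU.1 /\ open KU.2]
  (fun KU => maps_into KU.1 KU.2) (K, V°)).
Qed.

(** A finite intersection of subbasic sets contains one set of the same form:
    the compact sets are united and the open sets intersected, where an empty
    compact set is skipped because its open set need not contain [y0]. *)
Lemma nbhs_CI_cst (X Y : topologicalType) (I : set (set X)) (y0 : Y) O :
  compact_ideal I -> I !=set0 ->
  nbhs (CI_cst I y0) (O : set (CI I Y)) ->
  exists K V, [/\ I K, nbhs y0 V & maps_into K V `<=` O].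
Proof.
move=> [_ _ IU II] [K0 IK0]; rewrite (@nbhsE (CI I Y)).
move=> -[_ [[D DI <-] [C DC C0]] DO].
have I0 : I set0 by rewrite -(setI0 K0); apply: II => //; exact: compact0.
have [Z ZI CE] : finI_from [set KU : set X * set Y | I KU.1 /\ open KU.2]
  (fun KU => @maps_into X Y KU.1 KU.2) C by exact: DI.
have {}C0 KU : KU \in Z -> @maps_into X Y KU.1 KU.2 (cst y0).
  by have : (C : set (continuousType X Y)) (cst y0) by []; rewrite -CE; exact.
exists (\bigcup_(KU in [set` Z]) KU.1).
exists (\bigcap_(KU in [set` Z]) [set y | KU.1 !=set0 -> KU.2 y]); split.
- rewrite bigcup_fset big_seq; apply: big_ind => //= KU ZKU.
  by have /set_mem[] := ZI _ ZKU.
- apply: filter_bigI => KU ZKU.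
  have [[x Kx]|nK] := pselect (KU.1 !=set0); last first.
    by apply: filterS filterT => y _ /nK.
  have /set_mem[_ oU] := ZI _ ZKU.
  apply: filterS (open_nbhs_nbhs (conj oU _)); first by move=> y Uy _.
  by apply: (C0 _ ZKU); exists x.
- move=> f fKV; apply: DO; exists C => //.
  suff : (C : set (continuousType X Y)) f by [].
  rewrite -CE => KU ZKU _ [x Kx <-].
  by apply: (fKV (f x) _ KU ZKU); [exists x => //; exists KU|exists x].
Qed.

Theorem theorem2p2 (X : topologicalType) (hX : hausdorff_space X)
    (hN : exists N : set (set X), countable N /\ k_network N)
    (I : set (set X)) (hI : compact_ideal I) (hIc : discretely_complete I)
    (Y : topologicalType) (y0 : Y) (hY : strong_pytkeev_at y0) :
  strong_pytkeev_at (CI_cst I y0).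
Proof.
have [N [cN kN]] := hN.
have [MM [cMM HMM]] := countable_k_network_outer cN kN.
have [PP [cPP HPP]] := pytkeev_inner_sequence hY.
exists [set (maps_into MP.1 MP.2 : set (CI I Y)) | MP in MM `*` PP]; split.
  exact/countable_image/countableX.
move=> O A nO accA.
(* When [X] is empty the ideal may be empty too, but then there is only one
   function and no infinite set of functions. *)
have [[x0 _]|nX] := pselect (exists x : X, True); last first.
  have := accA _ filterT; rewrite setTI; case.
  apply: sub_finite_set (finite_set1 (CI_cst I y0)) => f _.
  by apply/continuousEP => x; case: nX; exists x.
have [Ic IT _ _] := hI.
have [L IL _] : (\bigcup_(K in I) K) x0 by rewrite IT.
have [K [U [IK yU KUO]]] := nbhs_CI_cst hI (ex_intro _ L IL) nO.
have [M [MMM KM]] := HMM K (Ic _ IK).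
have [P [PPP PU yP]] := HPP U yU.
have [|n nA] := infinite_into_inner (A := A) x0 hX hY (Ic _ IK) KM yP hIc IK.
  move=> L' V IL' yV; rewrite setIC; apply: accA.
  exact: nbhs_CI_cst_maps_into.
exists (maps_into (M n) (P n)); split; last by rewrite setIC.
- by exists (M n, P n) => //; split; [exact: MMM|exact: PPP].
- apply: subset_trans KUO; have [KMn _ _] := KM.
  exact: maps_intoS (KMn n) (PU n).
Qed.
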